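(* Let $\mathcal{X}$ be a class of groups such that each nonabelian $H \in \mathcal{X}$ is CSA. Let $G$ be a nonabelian group that is residually $\mathcal{X}$. Then the following are equivalent: (1) $G$ is fully residually $\mathcal{X}$; (2) $G$ is CSA; (3) $G$ is CT. Therefore the class $\mathcal{X}$ has the property $B\mathcal{X}$.
   Context: Let $\mathcal{X}$ be a class of groups. A group $G$ is residually $\mathcal{X}$ if for every nontrivial $g \in G$ there is a homomorphism $\phi: G \to H$ with $H \in \mathcal{X}$ and $\phi(g) \neq 1$. $G$ is fully residually $\mathcal{X}$ if for every finite set of nontrivial elements $g_1,\dots,g_n \in G$ there is a homomorphism $\phi: G \to H$ with $H \in \mathcal{X}$ and $\phi(g_i) \neq 1$ for all $i=1,\dots,n$. A group $G$ is commutative transitive (CT) if for all nontrivial $x,y,z \in G$, $[x,y]=1$ and $[y,z]=1$ imply $[x,z]=1$. A subgroup $M \le G$ is malnormal if $g^{-1}Mg \cap M \neq \{1\}$ implies $g \in M$. A group is CSA (conjugately separated abelian) if all its maximal abelian subgroups are malnormal. A class $\mathcal{X}$ satisfies (has the property) $B\mathcal{X}$ if every nonabelian group $G$ is fully residually $\mathcal{X}$ if and only if $G$ is residually $\mathcal{X}$ and CT. *)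

(* Defs.v *)
From mathcomp Require Import ssreflect ssrfun ssrbool eqtype choice ssrnat seq.
From mathcomp Require Import monoid.
From mathcomp Require Import boolp classical_sets.

Set Implicit Arguments.
Unset Strict Implicit.
Unset Printing Implicit Defensive.

Local Open Scope classical_set_scope.
Local Open Scope group_scope.

(* Groups are [groupType]s, with no finiteness assumption.  Such a type carries
   a choice operator, which is no restriction under the classical axioms of
   [boolp]: every type is then a [choiceType].  A class of groups is an
   arbitrary predicate on [groupType]. *)

Definition is_abelian (G : groupType) : Prop := forall x y : G, commute x y.

Definition residually (X : groupType -> Prop) (G : groupType) : Prop :=
  forall g : G, g != 1 ->
    exists (H : groupType) (phi : {multiplicative G -> H}), X H /\ phi g != 1.

Definition fully_residually (X : groupType -> Prop) (G : groupType) : Prop :=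
  forall s : seq G, {in s, forall g, g != 1} ->
    exists (H : groupType) (phi : {multiplicative G -> H}),
      X H /\ {in s, forall g, phi g != 1}.

Definition commutative_transitive (G : groupType) : Prop :=
  forall x y z : G, x != 1 -> y != 1 -> z != 1 ->
    [~ x, y] = 1 -> [~ y, z] = 1 -> [~ x, z] = 1.

Definition abelian_subgroup (G : groupType) (M : set G) : Prop :=
  group_closed [in M] /\ {in M &, forall x y, commute x y}.

Definition maximal_abelian (G : groupType) (M : set G) : Prop :=
  abelian_subgroup M /\
  forall N : set G, abelian_subgroup N -> M `<=` N -> N = M.

(* [m ^ g] is [g^-1 * (m * g)]. *)
Definition malnormal (G : groupType) (M : set G) : Prop :=
  forall g : G, [set m ^ g | m in M] `&` M <> [set 1] -> g \in M.

Definition CSA (G : groupType) : Prop :=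
  forall M : set G, maximal_abelian M -> malnormal M.

Definition has_property_B (X : groupType -> Prop) : Prop :=
  forall G : groupType, ~ is_abelian G ->
    (fully_residually X G <-> residually X G /\ commutative_transitive G).

(* Main.v *)
Require Import Defs.
From mathcomp Require Import ssreflect ssrfun ssrbool eqtype choice ssrnat seq.
From mathcomp Require Import monoid.
From mathcomp Require Import boolp classical_sets.

Set Implicit Arguments.
Unset Strict Implicit.
Unset Printing Implicit Defensive.

(** The implication from CT to fully residually X goes through one witness:
    if a and b are nontrivial, some conjugate b ^ c does not commute with a, and
    any homomorphism not killing [~ a, b ^ c] kills neither a nor b; iterating
    over a finite list gives a single element that must survive.  Such a c
    exists because otherwise, by CT, b commutes with all its conjugates; choose
    g with [~ b, g] <> 1 and a homomorphism to a group of X that does not kill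
    it.  That group is nonabelian, hence CSA, and there the image of b commutes
    with its conjugate by the image of g, so with the image of g itself. *)

Local Open Scope classical_set_scope.
Local Open Scope group_scope.

Lemma not_abelianP (G : groupType) :
  ~ is_abelian G <-> exists x y : G, [~ x, y] != 1.
Proof.
split=> [nabG | [x [y /commgP nxy]] abG]; last exact: nxy (abG x y).
apply: contrapT => nex; apply: nabG => x y; apply/commgP/negPn/negP => nxy.
by apply: nex; exists x, y.
Qed.

(* [gmulfJ] and [gmulfR] ask for a morphism bundled with [f 1 = 1], which
   [{multiplicative G -> H}] does not provide. *)
Lemma multiplicativeJ (G H : groupType) (phi : {multiplicative G -> H}) :
  {morph phi : x y / x ^ y}.
Proof.
by move=> x y; apply: (mulgI (phi y)); rewrite -gmulfM -!conjgC gmulfM.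
Qed.

Lemma multiplicativeR (G H : groupType) (phi : {multiplicative G -> H}) :
  {morph phi : x y / [~ x, y]}.
Proof.
by move=> x y; apply: (mulgI (phi y * phi x)); rewrite -commgC -!gmulfM -commgC.
Qed.

Lemma morph_not_abelian (G H : groupType) (phi : {multiplicative G -> H})
    (x y : G) :
  phi [~ x, y] != 1 -> ~ is_abelian H.
Proof.
rewrite multiplicativeR => nxy.
by apply/not_abelianP; exists (phi x), (phi y).
Qed.

(* Zorn is applied to pairwise commuting subsets rather than to subgroups: a
   maximal one equals its own centralizer, hence is a subgroup. *)
Lemma commuting_sub_maximal_abelian (G : groupType) (S : set G) :
  (forall x y, S x -> S y -> commute x y) ->
  exists2 M : set G, maximal_abelian M & S `<=` M.
Proof.
(* [S] is built into [P] so that the union of the empty chain still satisfies it, and so that a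
   maximal [A] is forced to contain [S]. *)
move=> cS; pose P (A : set G) :=
  forall x y, (S `|` A) x -> (S `|` A) y -> commute x y.
have [F FP Ftot|A [PA maxA]] := @Zorn_bigcup G P.
  have SF x : (S `|` \bigcup_(X in F) X) x -> S x \/ exists2 A, F A & A x.
    by case=> [Sx|[A FA Ax]]; [left | right; exists A].
  move=> x y /SF Fx /SF Fy.
  have cSF B u v : F B -> S u -> B v -> commute u v.
    by move=> /FP PB Su Bv; apply: PB; [left | right].
  case: Fx Fy => [Sx|[A FA Ax]] [Sy|[B FB By]]; first exact: cS.
  - exact: (cSF _ _ _ FB Sx By).
  - exact/commute_sym/(cSF _ _ _ FA Sy Ax).
  - by have [/(_ x Ax) Bx|/(_ y By) Ay] := Ftot A B FA FB;
      [apply: (FP B FB); right | apply: (FP A FA); right].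
have centA x : (forall y, (S `|` A) y -> commute x y) -> A x.
  move=> cx; apply: contrapT => nAx; apply: (maxA (x |` A)).
    by split=> [|/(_ x (or_introl erefl))] // y; right.
  have cases y : (S `|` (x |` A)) y -> y = x \/ (S `|` A) y.
    by case=> [Sy|[->|Ay]]; [right; left | left | right; right].
  move=> u v /cases[->|Au] /cases[->|Av]; first exact: commute_refl.
  - exact: cx.
  - exact/commute_sym/cx.
  - exact: PA.
have SA : S `<=` A by move=> x Sx; apply: centA => y Ay; apply: PA => //; left.
have cA x y : A x -> A y -> commute x y by move=> Ax Ay; apply: PA; right.
have SUA : S `|` A = A by apply/setUidr.
exists A => //; split.
  split; last by move=> x y; rewrite !inE; exact: cA.
  split=> [|x y /set_mem Ax /set_mem Ay]; apply/mem_set/centA => z;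
    rewrite SUA => Az.
    exact/commute_sym/commute1.
  by apply/commute_sym/commuteM/commuteV; exact: cA.
move=> N [_ cN] AN; apply/seteqP; split=> // x Nx.
by apply: centA => y; rewrite SUA => Ay; apply: cN;
   apply: mem_set => //; exact: AN.
Qed.

Lemma maximal_abelian_cent (G : groupType) (M : set G) (g : G) :
  maximal_abelian M -> (forall m, M m -> commute m g) -> M g.
Proof.
move=> [[_ cM] maxM] cg.
have [|N [abN _] MN] := @commuting_sub_maximal_abelian G (g |` M).
  move=> x y [->|Mx] [->|My]; first exact: commute_refl.
  - exact/commute_sym/cg.
  - exact: cg.
  - by apply: cM; exact: mem_set.
rewrite -(maxM N abN); first by apply: MN; left.
by move=> x Mx; apply: MN; right.
Qed.

(* Both sets contain 1, so the intersection differs from [set 1] exactly when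
   it has a nontrivial element. *)
Lemma malnormalP (G : groupType) (M : set G) : M 1 ->
  malnormal M <-> forall g x, x != 1 -> M x -> M (x ^ g) -> M g.
Proof.
move=> M1; split=> [malM g x nx Mx Mxg | malM g ntM].
  apply/set_mem/malM => eqM.
  have xgM : ([set m ^ g | m in M] `&` M) (x ^ g) by split=> //; exists x.
  by move: xgM; rewrite eqM => /eqP; rewrite conjg_eq1 (negPf nx).
apply/mem_set; apply: contrapT => nMg; apply: ntM; apply/seteqP.
split=> [_ [[m Mm <-] Mmg]|_ ->].
  apply/eqP; rewrite conjg_eq1; apply/negPn/negP => nm.
  exact: (nMg (malM g m nm Mm Mmg)).
by split=> //; exists 1 => //; rewrite conj1g.
Qed.

(** A maximal abelian [M] containing [x] and [x ^ g] meets its conjugate by [g] in the nontrivial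
    [x ^ g], so malnormality puts [g] in [M]. *)
Lemma CSA_commute_conj (G : groupType) (x g : G) :
  CSA G -> x != 1 -> commute x (x ^ g) -> commute x g.
Proof.
move=> csaG nx cxg.
have [|M maxM SM] := @commuting_sub_maximal_abelian G [set x; x ^ g].
  by move=> _ _ [->|->] [->|->] //; exact: commute_sym.
have [[[/set_mem M1 _] cM] _] := maxM.
have Mx : M x by apply: SM; left.
have Mg : M g.
  by apply: ((malnormalP M1).1 (csaG M maxM) g x nx Mx _); apply: SM; right.
by apply: cM; exact: mem_set.
Qed.

(** Take a maximal abelian [M] containing [x] and [y]. As [y ^ z = y] is nontrivial, malnormality
    puts [z] in [M] next to [x]. *)
Lemma CSA_commute_trans (G : groupType) (x y z : G) :
  CSA G -> y != 1 -> commute x y -> commute y z -> commute x z.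
Proof.
move=> csaG ny cxy cyz.
have [|M maxM SM] := @commuting_sub_maximal_abelian G [set x; y].
  by move=> _ _ [->|->] [->|->] //; exact: commute_sym.
have [[[/set_mem M1 _] cM] _] := maxM.
have [Mx My] : M x /\ M y by split; apply: SM; [left | right].
have Mz : M z.
  apply: ((malnormalP M1).1 (csaG M maxM) z y ny My _).
  by have /commgP/conjg_fixP -> := cyz.
by apply: cM; exact: mem_set.
Qed.

Lemma CSA_CT (G : groupType) : CSA G -> commutative_transitive G.
Proof.
move=> csaG x y z _ ny _ /eqP/commgP cxy /eqP/commgP cyz.
exact/eqP/commgP/(CSA_commute_trans csaG ny cxy cyz).
Qed.

Lemma fully_residually_residually (X : groupType -> Prop) (G : groupType) :
  fully_residually X G -> residually X G.
Proof.
move=> frG g ng; have [|H [phi [XH phi_s]]] := frG [:: g].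
  by move=> _ /[!inE] /eqP ->.
by exists H, phi; split=> //; apply: phi_s; rewrite inE.
Qed.

Section NonabelianCSA.

Variable X : groupType -> Prop.
Hypothesis hX : forall H : groupType, X H -> ~ is_abelian H -> CSA H.

Lemma fully_residually_CSA (G : groupType) : fully_residually X G -> CSA G.
Proof.
move=> frG M maxM; have [[[/set_mem M1 _] cM] _] := maxM.
apply/malnormalP => // g x nx Mx Mxg.
apply: (maximal_abelian_cent maxM) => m Mm; apply/commgP/negPn/negP => nmg.
(* Both elements must survive in the same [H]: the commutator makes [H] nonabelian, hence CSA, and
   the nontrivial [phi x] then links [phi m] to [phi g] by transitivity, a contradiction. *)
have [|H [phi [XH phi_s]]] := frG [:: x; [~ m, g]].
  by move=> _ /[!inE] /orP[] /eqP ->.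
have phix : phi x != 1 by apply: phi_s; rewrite !inE eqxx.
have phimg : phi [~ m, g] != 1 by apply: phi_s; rewrite !inE eqxx orbT.
have csaH := hX XH (morph_not_abelian phimg).
have cphixg : commute (phi x) (phi g).
  by apply: (CSA_commute_conj csaH phix); rewrite -multiplicativeJ;
     apply/gmulf_commute/cM; exact: mem_set.
have cphimx : commute (phi m) (phi x).
  by apply/gmulf_commute/cM; exact: mem_set.
move: phimg; rewrite multiplicativeR => /commgP; apply.
exact: (CSA_commute_trans csaH phix cphimx cphixg).
Qed.

Lemma CT_noncommuting_conj (G : groupType) (a b : G) :
  ~ is_abelian G -> residually X G -> commutative_transitive G ->
  a != 1 -> b != 1 -> exists c, [~ a, b ^ c] != 1.
Proof.
move=> /not_abelianP[u [v nuv]] resG ctG na nb.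
have [|cab] := pselect (exists c, [~ a, b ^ c] != 1) => //.
have {}cab c : [~ a, b ^ c] = 1.
  by apply/eqP/negPn/negP => nc; apply: cab; exists c.
(* The link is [a], which commutes with both [b = b ^ 1] and [b ^ g]. *)
have cbb g : [~ b, b ^ g] = 1.
  apply: (ctG b a (b ^ g)) => //; first by rewrite conjg_eq1.
  by apply/eqP; rewrite commg1_sym -[b]conjg1 cab.
(* Were [b] central, CT through [b] would make [u] and [v] commute. *)
have [g nbg] : exists g, [~ b, g] != 1.
  apply: contrapT => cb.
  have {}cb g : [~ b, g] = 1.
    by apply/eqP/negPn/negP => ng; apply: cb; exists g.
  have [nu nv] : u != 1 /\ v != 1.
    by split; apply: contra_neq nuv => ->; rewrite (comm1g, commg1).
  by case/eqP: nuv; apply: (ctG u b v nu nb nv) => //; apply/eqP;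
     rewrite commg1_sym cb.
have [H [phi [XH phibg]]] := resG _ nbg.
have csaH := hX XH (morph_not_abelian phibg).
move: phibg; rewrite multiplicativeR => nphibg.
case/negP: (nphibg); apply/commgP.
apply: (CSA_commute_conj csaH).
  by apply: contra_neq nphibg => ->; rewrite comm1g.
by rewrite -multiplicativeJ; apply/gmulf_commute/commgP/eqP.
Qed.

Lemma CT_fully_residually (G : groupType) :
  ~ is_abelian G -> residually X G -> commutative_transitive G ->
  fully_residually X G.
Proof.
move=> nabG resG ctG s ns.
have [w nw ws] : exists2 w : G, w != 1 &
    forall (H : groupType) (phi : {multiplicative G -> H}),
      phi w != 1 -> {in s, forall g, phi g != 1}.
  elim: s ns => [|a s IHs] ns.
    (* For the empty list any nontrivial element serves. *)
    by have [x [y nxy]] := (not_abelianP G).1 nabG; exists [~ x, y].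
  have [|w nw ws] := IHs; first by move=> g gs; apply: ns; rewrite inE gs orbT.
  have na : a != 1 by apply: ns; rewrite inE eqxx.
  have [c nawc] := CT_noncommuting_conj nabG resG ctG na nw.
  exists [~ a, w ^ c] => // H phi.
  rewrite multiplicativeR multiplicativeJ => nphi g; rewrite inE => /orP[/eqP -> | gs].
    by apply: contra_neq nphi => ->; rewrite comm1g.
  apply: ws gs; apply: contra_neq nphi => ->.
  by rewrite conj1g commg1.
have [H [phi [XH phiw]]] := resG w nw.
by exists H, phi; split=> //; exact: ws.
Qed.

End NonabelianCSA.

Theorem theorem3p1 (X : groupType -> Prop)
    (hX : forall H : groupType, X H -> ~ is_abelian H -> CSA H) :
  (forall G : groupType, ~ is_abelian G -> residually X G ->
     [<-> fully_residually X G; CSA G; commutative_transitive G]) /\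
  has_property_B X.
Proof.
split=> G nabG => [resG|].
  tfae; [exact: (fully_residually_CSA hX) | exact: CSA_CT |].
  exact: (CT_fully_residually hX nabG resG).
split=> [frG|[resG ctG]]; last exact: (CT_fully_residually hX nabG resG ctG).
split; first exact: fully_residually_residually.
exact: (CSA_CT (fully_residually_CSA hX frG)).
Qed.
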